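(* Let $n = p_1^{a_1}p_2^{a_2}\cdots p_r^{a_r}$ be the prime factorization of a positive integer $n$ with $p_1 < p_2 < \dots < p_r$. Then every group of order $n$ has an ordered Sylow tower if and only if $$\gcd\bigl(p_i^{a_i}p_{i+1}^{a_{i+1}}\cdots p_r^{a_r},\ \psi(p_i^{a_i})\bigr) = 1 \quad \text{for all } 1 \le i \le r.$$
   Context: $\psi$ is the multiplicative arithmetic function defined on prime powers by $\psi(p^k) = (p^k-1)(p^{k-1}-1)\cdots(p-1)$ (and $\psi(1)=1$). For a finite group $G$ of order $p_1^{a_1}\cdots p_r^{a_r}$ with $p_1<\dots<p_r$, $G$ has an ordered Sylow tower if there is a series $G = R_0 \supset R_1 \supset \dots \supset R_r = \{e\}$ with every $R_i$ normal in $G$ and $|R_{i-1}:R_i| = p_i^{a_i}$ for $i=1,\dots,r$. *)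

(* Defs.v *)
From mathcomp Require Import all_boot all_fingroup.
Set Implicit Arguments. Unset Strict Implicit. Unset Printing Implicit Defensive.

Local Open Scope nat_scope.

Definition psi_pp (p k : nat) : nat := \prod_(1 <= j < k.+1) (p ^ j - 1).

Definition psi (n : nat) : nat := \prod_(p <- primes n) psi_pp p (logn p n).

Definition ith_prime (n i : nat) : nat := nth 0 (primes n) i.
Definition ith_exp (n i : nat) : nat := logn (ith_prime n i) n.
Definition ith_pp (n i : nat) : nat := ith_prime n i ^ ith_exp n i.

Definition ordered_sylow_tower (gT : finGroupType) (G : {group gT}) : Prop :=
  let r := size (primes #|G|) in
  exists R : nat -> {group gT},
    [/\ R 0 = G, R r = 1%G,
        (forall i, i <= r -> (R i <| G)%g),
        (forall i, i < r -> (R i.+1 \subset R i)%g) &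
        (forall i, i < r -> #|R i : R i.+1|%g = ith_pp #|G| i)].

(* Main.v *)
Require Import Defs.
From mathcomp Require Import all_boot all_fingroup all_algebra all_solvable all_field.

(** The gcd condition says that for primes [p < q] dividing [n], [q] divides no
    [p ^ k - 1] with [1 <= k <= logn p n].

    If it holds, a [q]-subgroup normalising a [p]-subgroup [Q] centralises it:
    [q] divides [#|Q| - #|'C_Q(X)| = p ^ c * (p ^ (k - c) - 1)], which forces
    [c = k].  Hence all the quotients ['N_G(Q) / 'C_G(Q)] are [p]-groups for the
    smallest prime [p]; as in Frobenius' theorem a Sylow [p]-subgroup [S] then
    controls its own fusion, the transfer of [G] into [S / S^`(1)] is nontrivial,
    and induction on the kernel gives a normal [p]-complement.  Iterating over
    the primes in increasing order gives the tower.

    Conversely, if [q] divides [p ^ k - 1], an element of order [q] in the unit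
    group of the field with [p ^ k] elements acts nontrivially on its additive
    group.  In a group with an ordered Sylow tower every [q]-subgroup [A]
    normalising a [p]-subgroup [V] centralises it, because some normal
    [p']-subgroup [K] contains [A], so that [[~: A, V]] lies in [K :&: V = 1]. *)

Set Implicit Arguments. Unset Strict Implicit. Unset Printing Implicit Defensive.
Import GroupScope.

(** * Coprime action and control of fusion in a Sylow subgroup *)

Lemma qgroup_cent_pgroup (gT : finGroupType) (p q : nat) (Q X : {group gT}) :
    prime p -> prime q -> p != q -> p.-group Q -> q.-group X ->
    X \subset 'N(Q) ->
    (forall j, 0 < j <= logn p #|Q| -> ~~ (q %| p ^ j - 1)%N) ->
  X \subset 'C(Q).
Proof.
move=> p_pr q_pr neq_pq pQ qX nQX ndvd.
have: [acts X, on Q | 'J] by rewrite astabsJ.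
move/(pgroup_fix_mod qX); rewrite afixJ.
have pC : p.-group 'C_Q(X) by apply: pgroupS pQ; apply: subsetIl.
set c := logn p #|'C_Q(X)|.
have leck : c <= logn p #|Q| by rewrite dvdn_leq_log ?cardSg ?subsetIl.
have cardC : #|'C_Q(X)| = (p ^ c)%N by rewrite (card_pgroup pC).
have cardQ : #|Q| = (p ^ logn p #|Q|)%N by rewrite {1}(card_pgroup pQ).
move/eqP; rewrite eqn_mod_dvd ?subset_leq_card ?subsetIl // cardC {1}cardQ.
rewrite -{1}(subnK leck) expnD -{2}[(p ^ c)%N]mul1n -mulnBl Euclid_dvdM //.
rewrite Euclid_dvdX // (dvdn_prime2 q_pr p_pr) (eq_sym q) (negbTE neq_pq) orbF.
have [lt_ck | le_kc _] := ltnP c (logn p #|Q|).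
  move=> dvd_q; have := ndvd (logn p #|Q| - c)%N.
  by rewrite subn_gt0 lt_ck leq_subr dvd_q => /(_ isT).
rewrite centsC; suff /setIidPl: 'C_Q(X) = Q by [].
by apply/eqP; rewrite eqEcard subsetIl cardQ cardC leq_exp2l ?prime_gt1.
Qed.

(* Alperin-style descent: induction on [#|S| - #|S :&: T|], moving from [S] to
   [T] through Sylow subgroups of ['N_G(S :&: T)]. *)
Lemma Sylow_conj_cent (gT : finGroupType) (p : nat) (G : {group gT}) :
    (forall Q : {group gT}, Q \subset G -> p.-group Q ->
       p.-group ('N_G(Q) / 'C_G(Q))) ->
  forall S T : {group gT}, p.-Sylow(G) S -> p.-Sylow(G) T ->
  exists2 c, c \in 'C_G(S :&: T) & T :=: S :^ c.
Proof.
move=> pNC S T; have [m] := ubnP (#|S| - #|S :&: T|).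
elim: m S T => // m IHm S T ltm sylS sylT.
have [sSG sTG] := (pHall_sub sylS, pHall_sub sylT).
have [pS pT] := (pHall_pgroup sylS, pHall_pgroup sylT).
have [sST | not_sST] := boolP (S \subset T).
  exists 1; rewrite ?group1 // conjsg1; apply/eqP.
  by rewrite eq_sym eqEcard sST (card_Hall sylS) (card_Hall sylT) /=.
have not_sTS : ~~ (T \subset S).
  apply: contra not_sST => sTS; suff /eqP-> : S :==: T by [].
  by rewrite eq_sym eqEcard sTS (card_Hall sylS) (card_Hall sylT) /=.
pose D := (S :&: T)%G.
have sDG : D \subset G by rewrite subIset ?sSG.
have pD : p.-group D by apply: pgroupS pS; apply: subsetIl.
have prDS : D \proper 'N_S(D).
  apply: nilpotent_proper_norm (pgroup_nil pS) _.
  by rewrite properE subsetIl subsetI subxx.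
have prDT : D \proper 'N_T(D).
  apply: nilpotent_proper_norm (pgroup_nil pT) _.
  by rewrite properE subsetIr subsetI subxx andbT.
(* The induction hypothesis applies to Sylow subgroups meeting in more than [D]; an element
   centralising their larger intersection also centralises [D]. *)
have step (U V : {group gT}) : p.-Sylow(G) U -> p.-Sylow(G) V ->
    D \proper U :&: V -> exists2 c, c \in 'C_G(D) & V :=: U :^ c.
  move=> sylU sylV prD.
  case: (IHm U V) => // [|c]; last first.
    by move=> cc ->; exists c => //; apply: subsetP cc; rewrite setIS ?centS ?proper_sub.
  rewrite -ltnS; apply: leq_trans ltm; rewrite ltnS.
  have -> : #|S| = #|U| by rewrite (card_Hall sylS) (card_Hall sylU).
  apply: ltn_sub2l; last exact: proper_card.
  by apply: leq_trans (proper_card prD) (subset_leq_card (subsetIl _ _)).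
have [A sylA sSA] := Sylow_superset (setSI 'N(D) sSG) (pgroupS (subsetIl _ _) pS : p.-group 'N_S(D)).
have [B sylB sTB] := Sylow_superset (setSI 'N(D) sTG) (pgroupS (subsetIl _ _) pT : p.-group 'N_T(D)).
have sAN := pHall_sub sylA.
have nCN : 'N_G(D) \subset 'N('C_G(D)).
  by rewrite normsI ?norms_cent ?subIset ?subxx ?orbT // normsG.
(* As ['N_G(D) / 'C_G(D)] is a [p]-group, the Sylow subgroup [A] maps onto it. Hence [A] and [B] are
   conjugate by an element [c] of ['C_G(D)]. *)
have defN : 'N_G(D) :=: A * 'C_G(D).
  apply/eqP; rewrite eqEsubset mul_subG // ?setIS ?cent_sub // andbT.
  have := quotient_pHall (subset_trans sAN nCN) sylA.
  move/pHall_id => /(_ (pNC _ sDG pD)) eqA.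
  by rewrite (normC (subset_trans sAN nCN)) -quotientSK // eqA.
have [x Nx defB] := Sylow_trans sylA sylB.
have [a Aa [c Cc def_x]] : exists2 a, a \in A & exists2 c, c \in 'C_G(D) & x = a * c.
  have: x \in A * 'C_G(D) by rewrite -defN.
  by case/mulsgP=> a c Aa Cc ->; exists a => //; exists c.
have defBc : B :=: A :^ c by rewrite defB def_x conjsgM (conjGid Aa).
have Gc : c \in G by case/setIP: Cc.
have pA := pHall_pgroup sylA.
have sAG : A \subset G := subset_trans sAN (subsetIl _ _).
(* The route is from [S] to [U], to [U :^ c], to [T]. The outer moves fall under [step]: [S :&: U]
   contains ['N_S(D)], and [U :^ c :&: T] contains ['N_T(D)], both larger than [D]. *)
have [U sylU sAU] := Sylow_superset sAG pA.
have sylUc : p.-Sylow(G) (U :^ c) by rewrite pHallJ.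
have [c1 Cc1 defU] : exists2 c, c \in 'C_G(D) & U :=: S :^ c.
  apply: step => //; apply: proper_sub_trans prDS _.
  by rewrite subsetI subsetIl (subset_trans sSA sAU).
have [c2 Cc2 defT] : exists2 c', c' \in 'C_G(D) & T :=: (U :^ c)%G :^ c'.
  apply: step => //; apply: proper_sub_trans prDT _.
  by rewrite subsetI subsetIl andbT (subset_trans sTB) // defBc conjSg.
exists (c1 * c * c2); first by rewrite !groupM.
by rewrite defT /= defU !conjsgM.
Qed.

(** Since [x ^ g] lies in both [S :^ g] and [S], some [c] centralising it carries [S :^ g] back to
    [S]. Then [g * c] normalises [S], and ['N_G(S)] is covered by [S * 'C_G(S)], so [g * c] acts on
    [x] as an element of [S]. *)
Lemma Sylow_control_fusion (gT : finGroupType) (p : nat) (G S : {group gT}) :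
    (forall Q : {group gT}, Q \subset G -> p.-group Q ->
       p.-group ('N_G(Q) / 'C_G(Q))) ->
  p.-Sylow(G) S -> {in S & G, forall x g, x ^ g \in S ->
    exists2 s, s \in S & x ^ g = x ^ s}.
Proof.
move=> pNC sylS x g Sx Gg Sxg.
have [sSG pS] := (pHall_sub sylS, pHall_pgroup sylS).
have sylSg : p.-Sylow(G) (S :^ g) by rewrite pHallJ.
have [c Cc defS] := Sylow_conj_cent pNC sylSg sylS.
have cxg : (x ^ g) ^ c = x ^ g.
  case/setIP: Cc => _ /centP/(_ (x ^ g)) cc.
  by rewrite conjgE -cc ?mulKg // inE Sxg memJ_conjg Sx.
have Ngc : g * c \in 'N_G(S).
  rewrite inE groupM ?(subsetP (subsetIl _ _) _ Cc) //=.
  by apply/normP; rewrite conjsgM -defS.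
have sSN : S \subset 'N_G(S) by rewrite subsetI sSG normG.
have nCN : 'N_G(S) \subset 'N('C_G(S)).
  by rewrite normsI ?norms_cent ?subIset ?subxx ?orbT // normsG.
have sylSN : p.-Sylow('N_G(S)) S by apply: pHall_subl sSN (subsetIl _ _) sylS.
have eqS : S / 'C_G(S) = 'N_G(S) / 'C_G(S).
  have := quotient_pHall (subset_trans sSN nCN) sylSN.
  by move/pHall_id => /(_ (pNC _ sSG pS)).
have : g * c \in S * 'C_G(S).
  by apply: subsetP Ngc; rewrite (normC (subset_trans sSN nCN)) -quotientSK ?eqS.
case/mulsgP=> s d Ss /setIP[_ Cd] def_gc; exists s => //.
by rewrite -cxg -conjgM def_gc conjgM [LHS]conjgE -(centP Cd) ?groupJ // mulKg.
Qed.

(** * Transfer and normal [p]-complements *)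

(** The subgroup [K] is the kernel of the transfer of [G] into
    [S / S^](1)[. It is proper because an element]u[of]S[outside]S^[(1)], which exists as [S] is
    solvable and nontrivial, has nontrivial transfer. *)
Lemma fusion_normal_pquotient (gT : finGroupType) (p : nat) (G S : {group gT}) :
    p.-Sylow(G)%g S -> S :!=: 1%g ->
    {in S & G, forall x g, (x ^ g)%g \in S ->
      exists2 s, s \in S & (x ^ g = x ^ s)%g} ->
  exists2 K : {group gT}, (K <| G)%g & p.-group (G / K)%g && (K \proper G).
Proof.
move=> sylS ntS fusS.
have [sSG pS] := (pHall_sub sylS, pHall_pgroup sylS).
have nS'S : (S \subset 'N(S^`(1)))%g by apply: der_norm.
pose alpha := restrm_morphism nS'S (coset_morphism S^`(1)).
have im_alpha : (alpha @* S = S / S^`(1))%g.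
  by rewrite /= morphim_restrm setIid.
have abA : (abelian (alpha @* S))%g by rewrite im_alpha der_abelian.
pose V := transfer_morphism G abA.
exists ('ker V)%G => /=; first exact: ker_normal.
apply/andP; split.
  have isoV := first_isog V.
  rewrite (isog_pgroup p isoV).
  apply: pgroupS (subsetT _) _.
  rewrite /pgroup cardsT.
  rewrite card_sub.
  have -> : #|[pred x in (alpha @* S)%G]| = #|alpha @* S| by apply: eq_card.
  by rewrite im_alpha; apply: quotient_pgroup.
have [u Su nS'u] : exists2 u, u \in S & u \notin (S^`(1))%g.
  apply/subsetPn; move: (sol_der1_proper (pgroup_sol pS) (subxx S) ntS).
  by rewrite properE => /andP[].
have Gu := subsetP sSG u Su.
rewrite properE (normal_sub (ker_normal _)) /=.
apply: contra nS'u => /subsetP/(_ u Gu) /mker Vu.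
have [X trX] : {X : {set gT} | is_transversal X (rcosets S G :* <[u]>)%g G}.
  exists (transversal (rcosets S G :* <[u]>)%g G).
  exact: (transversalP (rcosets_cycle_partition sSG Gu)).
(* By fusion control each factor of the transfer of [u] contributes a power of
   the image of [u], so the transfer is the power of exponent [#|G : S|]. *)
have alphaX x : x \in X ->
    alpha ((u ^+ #|<[u]> : S :* x|) ^ x^-1) = alpha u ^+ #|<[u]> : S :* x|.
  move=> Xx; set n := #|_ : _|.
  have Gx: x \in G by apply: (subsetP (transversal_sub trX)).
  have Sun : u ^+ n \in S by rewrite groupX.
  have Sunx : (u ^+ n) ^ x^-1 \in S.
    have := mulg_exp_card_rcosets S u x.
    by rewrite mem_rcoset conjgE invgK mulgA.
  have [|s Ss ->] := fusS _ x^-1 Sun _ Sunx; first by rewrite groupV.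
  rewrite morphJ // morphX // conjgE.
  have: commute (alpha u ^+ n) (alpha s).
    apply: (centsP abA); last exact: mem_morphim.
    by rewrite -morphX // mem_morphim.
  by move=> ->; rewrite mulKg.
have Sau : alpha u \in alpha @* S by apply: mem_morphim.
have {}Vu : alpha u ^+ #|G : S| = 1.
  move: Vu; rewrite /= (transfer_cycle_expansion sSG abA Gu trX) /=.
  rewrite (eq_bigr (fun x => (FiniteModule.fmod abA (alpha u)) *+ #|<[u]> : S :* x|)%R); last first.
    by move=> x Xx; rewrite -FiniteModule.fmodX // -alphaX.
  rewrite GRing.sumrMnr (sum_index_rcosets_cycle sSG Gu trX).
  rewrite -FiniteModule.fmodX // => /FiniteModule.congr_fmod.
  by rewrite FiniteModule.fmodK ?groupX.
apply: coset_idr; first exact: (subsetP nS'S).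
change (alpha u = 1); apply/eqP; rewrite -order_eq1 -dvdn1.
(* The order of [alpha u] is a power of [p], while [#|G : S|] is prime to [p]; so
   [alpha u ^+ #|G : S| = 1] would force [alpha u = 1]. *)
have cop : coprime #[alpha u] #|G : S|.
  apply: (@pnat_coprime p).
    by apply: morph_p_elt; last exact: (mem_p_elt pS).
  by case/and3P: sylS.
have : #[alpha u] %| gcdn #[alpha u] #|G : S|.
  by rewrite dvdn_gcd dvdnn order_dvdn Vu eqxx.
by rewrite (eqP cop).
Qed.

(** The [p']-core of the transfer kernel [K] is characteristic in [K], hence normal in [G], and it
    stays a Hall subgroup of [G] because [G / K] is a [p]-group. *)
Lemma p'core_Hall (gT : finGroupType) (p : nat) (G : {group gT}) :
    prime p ->
    (forall q j, prime q -> q %| #|G| -> q != p -> 0 < j <= logn p #|G| ->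
       ~~ (q %| p ^ j - 1)%N) ->
  p^'.-Hall(G) 'O_p^'(G).
Proof.
move=> p_pr; have [m] := ubnP #|G|; elim: m G => // m IHm G ltm ndvd.
have [S sylS] := Sylow_exists p G.
have [S1 | ntS] := eqVneq (gval S) 1.
  have p'G : p^'.-group G.
    by case/and3P: sylS => _ _; rewrite S1 indexg1.
  by rewrite pcore_pgroup_id // pHallE subxx part_pnat_id /=.
have pNC (Q : {group gT}) : Q \subset G -> p.-group Q ->
    p.-group ('N_G(Q) / 'C_G(Q)).
  move=> sQG pQ; apply/pgroupP=> q q_pr q_dvd; rewrite inE.
  apply/negPn/negP=> neq_qp.
  have [X sylX] := Sylow_exists q 'N_G(Q).
  have [sXN qX q'X] := and3P sylX.
  have [sXG nQX] := subsetIP sXN.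
  have nCN : 'C_G(Q) <| 'N_G(Q).
    by rewrite /normal setIS ?cent_sub // normsI ?norms_cent ?subIset ?subxx ?orbT // normsG.
  have sXC : X \subset 'C_G(Q).
    rewrite subsetI sXG; apply: (qgroup_cent_pgroup p_pr q_pr _ pQ qX nQX).
      by rewrite eq_sym.
    move=> j /andP[j_gt0 lejQ]; apply: ndvd => //.
      apply: dvdn_trans q_dvd _; apply: dvdn_trans (dvdn_quotient _ _) _.
      exact: cardSg (subsetIl _ _).
    rewrite j_gt0; apply: leq_trans lejQ _.
    by rewrite dvdn_leq_log ?cardSg.
  (* The centraliser contains the Sylow [q]-subgroup [X], so a factor [q] of [#|'N_G(Q) : 'C_G(Q)|]
     would divide the index of [X]. *)
  suff q_dvd_X : q %| #|'N_G(Q) : X|.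
    by have := pnatP _ (indexg_gt0 _ _) q'X q q_pr q_dvd_X; rewrite !inE eqxx.
  apply: dvdn_trans (indexgS _ sXC).
  by rewrite -card_quotient ?normal_norm.
have [K nKG /andP[pGK prK]] :=
  fusion_normal_pquotient sylS ntS (Sylow_control_fusion pNC sylS).
have sKG := normal_sub nKG.
have hallK : p^'.-Hall(K) 'O_p^'(K).
  apply: IHm; first by apply: leq_trans (proper_card prK) _.
  move=> q j q_pr q_dvd neq_qp /andP[j_gt0 lej]; apply: ndvd => //.
    exact: dvdn_trans q_dvd (cardSg sKG).
  by rewrite j_gt0 (leq_trans lej) // dvdn_leq_log ?cardSg.
have hallG : p^'.-Hall(G) 'O_p^'(K).
  apply/and3P; split; first exact: subset_trans (pcore_sub _ _) sKG.
    exact: pcore_pgroup.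
  rewrite -(Lagrange_index sKG (pcore_sub _ _)) pnatM.
  apply/andP; split; last by case/and3P: hallK.
  by rewrite -card_quotient ?normal_norm // (eq_pnat _ (negnK _)).
rewrite (normal_Hall_pcore hallG) //.
exact: gFnormal_trans.
Qed.

(** * The gcd condition in terms of pairs of primes *)

Lemma psi_prime_power (p k : nat) : prime p -> 0 < k -> psi (p ^ k) = psi_pp p k.
Proof.
move=> p_pr k_gt0.
by rewrite /psi primesX // primes_prime // big_seq1 pfactorK.
Qed.

Lemma prime_dvd_prod_seq (I : eqType) (q : nat) (s : seq I) (F : I -> nat) :
  prime q -> reflect (exists2 i, i \in s & q %| F i) (q %| \prod_(i <- s) F i).
Proof.
move=> q_pr; elim: s => [|i s IHs].
  by rewrite big_nil Euclid_dvd1 //; constructor; case.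
rewrite big_cons Euclid_dvdM //; apply: (iffP orP) => [[dv|/IHs[j sj dv]]|[j]].
- by exists i; rewrite ?mem_head.
- by exists j; rewrite // inE sj orbT.
rewrite inE => /predU1P[-> | sj] dv; first by left.
by right; apply/IHs; exists j.
Qed.

Lemma dvd_psi_pp (q p k : nat) : prime q ->
  reflect (exists2 j, 0 < j <= k & q %| p ^ j - 1)%N (q %| psi_pp p k).
Proof.
move=> q_pr; apply: (iffP (prime_dvd_prod_seq _ _ q_pr)) => [[j]|[j]].
  by rewrite mem_index_iota ltnS => ? ?; exists j.
by move=> ? ?; exists j; rewrite // mem_index_iota ltnS.
Qed.

Lemma ith_prime_mem (n i : nat) : i < size (primes n) -> ith_prime n i \in primes n.
Proof. exact: mem_nth. Qed.

Lemma ith_prime_ltn (n i j : nat) :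
  i < j -> j < size (primes n) -> ith_prime n i < ith_prime n j.
Proof.
move=> lt_ij lt_jr.
apply: (sorted_ltn_nth ltn_trans 0%N (sorted_primes n)) => //.
by rewrite inE (ltn_trans lt_ij).
Qed.

Lemma gcd_psi_eq1P (n : nat) :
  (forall i, i < size (primes n) ->
     gcdn (\prod_(i <= j < size (primes n)) ith_pp n j) (psi (ith_pp n i)) = 1%N)
  <->
  {in primes n &, forall p q, p < q ->
     forall k, 0 < k <= logn p n -> ~~ (q %| p ^ k - 1)%N}.
Proof.
set r := size _; split=> [gcd1 p q p_n q_n lt_pq k le_k | ndvd i lt_ir].
  apply/negP=> q_dvd.
  have := p_n; rewrite mem_primes => /and3P[p_pr n_gt0 p_dvd].
  have := q_n; rewrite mem_primes => /and3P[q_pr _ q_dvd_n].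
  have lt_ir : index p (primes n) < r by rewrite index_mem.
  have lt_jr : index q (primes n) < r by rewrite index_mem.
  have := gcd1 _ lt_ir; rewrite /ith_pp /ith_exp.
  have -> : ith_prime n (index p (primes n)) = p by apply: nth_index.
  rewrite psi_prime_power ?logn_gt0 // => gcd_pq.
  suff: q %| 1%N by rewrite Euclid_dvd1.
  rewrite -gcd_pq dvdn_gcd; apply/andP; split; last first.
    by apply/dvd_psi_pp; last exists k.
  apply/prime_dvd_prod_seq => //; exists (index q (primes n)).
    rewrite mem_index_iota lt_jr andbT leqNgt; apply/negP=> lt_ji.
    have := ith_prime_ltn lt_ji lt_ir; rewrite /ith_prime !nth_index //.
    by rewrite ltnNge ltnW.
  rewrite /ith_prime nth_index // Euclid_dvdX // dvdnn logn_gt0 //.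
have p_n := ith_prime_mem lt_ir; set p := ith_prime n i in p_n.
have := p_n; rewrite mem_primes => /and3P[p_pr n_gt0 p_dvd].
rewrite {2}/ith_pp psi_prime_power ?logn_gt0 //.
apply/eqP/negPn/negP=> gcd_neq1.
set d := gcdn _ _ in gcd_neq1.
have d_gt0 : 0 < d.
  (* Positivity is needed for every [j]: beyond the last prime, [ith_prime] defaults to 0 and
     [logn 0 n = 0], so the factor is [0 ^ 0 = 1]. *)
  rewrite gcdn_gt0 prodn_gt0 // => j; rewrite expn_gt0 /ith_exp.
  case: posnP => // ->.
  by rewrite ?logn0.
have d_gt1 : 1 < d by rewrite ltn_neqAle eq_sym gcd_neq1.
have q_pr := pdiv_prime d_gt1; set q := pdiv d in q_pr.
have := pdiv_dvd d; rewrite -/q dvdn_gcd => /andP[].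
case/(prime_dvd_prod_seq _ _ q_pr) => j; rewrite mem_index_iota => /andP[le_ij lt_jr].
have q_n := ith_prime_mem lt_jr.
have := q_n; rewrite mem_primes => /and3P[q'_pr _ _].
rewrite Euclid_dvdX // => /andP[]; rewrite dvdn_prime2 // => /eqP def_q _.
case/(dvd_psi_pp _ _ q_pr) => k le_k q_dvd.
have lt_pq : p < q.
  rewrite def_q; apply: ith_prime_ltn => //; rewrite ltn_neqAle le_ij andbT.
  (* The case [q = p] is excluded: [p] divides [p ^ k] and so cannot divide [p ^ k - 1]. *)
  apply: contraTneq q_dvd => eq_ij; rewrite def_q -eq_ij -/p.
  case/andP: le_k => k_gt0 _.
  by rewrite dvdn_subr ?expn_gt0 ?prime_gt0 ?Euclid_dvd1 // dvdn_exp.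
have q_n' : q \in primes n by rewrite def_q.
by case/negP: (ndvd p q p_n q_n' lt_pq k le_k).
Qed.

(** * Construction of the tower *)

Section Tower.

Variables (gT : finGroupType) (G : {group gT}).
Let n := #|G|.
Hypothesis ndvd : {in primes n &, forall p q, p < q ->
     forall k, 0 < k <= logn p n -> ~~ (q %| p ^ k - 1)%N}.

(** These are the primes of [n] from index [i] on; the term of index [i] in the tower is the core
    ['O_(pis i)(G)], shown to be a Hall subgroup. *)
Let pis i : nat_pred := [pred q | q \in drop i (primes n)].

Let drop_primes i : i < size (primes n) ->
  drop i (primes n) = ith_prime n i :: drop i.+1 (primes n).
Proof. exact: drop_nth. Qed.

Let lt_drop i q : i < size (primes n) -> q \in drop i.+1 (primes n) ->
  ith_prime n i < q.
Proof.
move=> lt_ir; have: sorted ltn (drop i (primes n)).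
  by apply: drop_sorted; apply: sorted_primes.
rewrite drop_primes //= => /(order_path_min ltn_trans)/allP; exact.
Qed.

Let part_step i (m := (n`_(pis i))%N) : i < size (primes n) ->
  [/\ (m`_(ith_prime n i))%N = ith_pp n i & (m`_(ith_prime n i)^')%N = (n`_(pis i.+1))%N].
Proof.
move=> lt_ir; rewrite /m /ith_pp /ith_exp -p_part -!partnI.
split; apply: eq_partn => q; rewrite !inE drop_primes // inE.
  by case: eqP => //=; rewrite ?andbF.
case: eqP => [-> | _] /=; last by rewrite andbT.
by apply/esym/negbTE/negP => /lt_drop; rewrite ltnn => /(_ lt_ir).
Qed.

(** All primes dividing [#|R|] other than [p] exceed [p], so [R] has a normal [p]-complement. Being
    characteristic in [R], it is normal in [G], and its order identifies it with the next core. *)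
Let Hall_step i : i < size (primes n) ->
  (pis i).-Hall(G) 'O_(pis i)(G) -> (pis i.+1).-Hall(G) 'O_(pis i.+1)(G).
Proof.
move=> lt_ir hallR; set R := 'O_(pis i)(G) in hallR.
have p_n := ith_prime_mem lt_ir.
set p := ith_prime n i in p_n.
have p_pr : prime p by move: p_n; rewrite mem_primes => /andP[].
have oR := card_Hall hallR.
have hallRp : p^'.-Hall(R) 'O_p^'(R).
  apply: p'core_Hall => // q j q_pr q_dvd neq_qp /andP[j_gt0 lej].
  have q_i : q \in drop i.+1 (primes n).
    have : q \in pis i by apply: (pgroupP (pcore_pgroup _ _)) q_dvd.
    by rewrite !inE drop_primes // inE (negPf neq_qp).
  apply: ndvd => //; first exact: mem_drop q_i.
    exact: lt_drop.
  by rewrite j_gt0 (leq_trans lej) ?dvdn_leq_log ?cardG_gt0 ?cardSg ?pcore_sub.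
have hallG : (pis i.+1).-Hall(G) 'O_p^'(R).
  rewrite pHallE (subset_trans (pcore_sub _ _) (pcore_sub _ _)) /=.
  by rewrite (card_Hall hallRp) oR; case: (part_step lt_ir) => _ ->.
rewrite (normal_Hall_pcore hallG) //.
exact: gFnormal_trans (pcore_normal _ _).
Qed.

Lemma ordered_sylow_tower_pcore : ordered_sylow_tower G.
Proof.
have hall i : i <= size (primes n) -> (pis i).-Hall(G) 'O_(pis i)(G).
  elim: i => [_|i IHi lt_ir]; last by apply: Hall_step => //; apply/IHi/ltnW.
  have piG : (pis 0).-group G by apply/pgroupP=> q q_pr q_dvd; rewrite inE drop0 mem_primes q_pr cardG_gt0.
  by rewrite pcore_pgroup_id // pHallE subxx part_pnat_id /=.
have sub_R i : i < size (primes n) -> 'O_(pis i.+1)(G) \subset 'O_(pis i)(G).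
  move=> lt_ir; apply: sub_pcore => q q_i.
  by rewrite inE drop_primes // inE; apply/orP; right.
exists (fun i => 'O_(pis i)(G)%G); split=> [||i _|i lt_ir|i lt_ir].
- apply/val_inj/pcore_pgroup_id/pgroupP=> q q_pr q_dvd.
  by rewrite inE drop0 mem_primes q_pr cardG_gt0.
- apply/val_inj/eqP; rewrite /= trivg_card1 (card_Hall (hall _ _)) //.
  by rewrite partn_eq1 ?cardG_gt0 //; apply/pnatP=> [|q _ _]; rewrite ?cardG_gt0 // !inE drop_size.
- exact: pcore_normal.
- exact: sub_R.
have [part_p part_p'] := part_step lt_ir.
rewrite -divgS ?sub_R // (card_Hall (hall _ lt_ir)) (card_Hall (hall _ (ltnW lt_ir))).
have := partnC (ith_prime n i) (part_gt0 (pis i) n).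
by rewrite part_p part_p' => <-; rewrite mulnK ?part_gt0.
Qed.

End Tower.

(** * The obstruction to a tower *)

Lemma ordered_sylow_tower_cent (gT : finGroupType) (G V A : {group gT}) (p q : nat) :
    ordered_sylow_tower G -> p < q -> prime p -> prime q -> p.-group V -> q.-group A ->
    V \subset G -> A \subset G -> A \subset 'N(V) -> A \subset 'C(V).
Proof.
case=> R [R0 _ nRG sR iR] lt_pq p_pr q_pr pV qA sVG sAG nVA.
have [V1 | ntV] := eqVneq (gval V) 1; first by rewrite V1 centsC sub1G.
have p_n : p \in primes #|G|.
  rewrite mem_primes p_pr cardG_gt0 (dvdn_trans _ (cardSg sVG)) //.
  by case: (pgroup_pdiv pV ntV).
set n := #|G| in p_n iR nRG sR.
pose i := index p (primes n).
have lt_ir : i < size (primes n) by rewrite index_mem.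
have pi : ith_prime n i = p by apply: nth_index.
have nK := nRG _ lt_ir; set K := R i.+1 in nK.
have iK j : j <= size (primes n) -> #|G : R j| = (\prod_(0 <= l < j) ith_pp n l)%N.
  elim: j => [|j IHj] lt_jr; first by rewrite R0 indexgg big_geq.
  rewrite big_nat_recr //= -IHj 1?ltnW // -iR //.
  by rewrite Lagrange_index ?sR // normal_sub // nRG // ltnW.
(* The index of [K] already contains the full [p]-part of [n], the factor of index [i]. *)
have p'K : p^'.-group K.
  apply/pgroupP=> l l_pr l_dvd; rewrite !inE; apply/eqP=> def_l.
  rewrite {l}def_l in l_pr l_dvd.
  have: (p ^ (logn p n).+1 %| #|K| * #|G : K|)%N.
    rewrite expnS dvdn_mul // iK // big_nat_recr //= dvdn_mull //.
    by rewrite /ith_pp /ith_exp pi.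
  by rewrite Lagrange ?normal_sub // pfactor_dvdn ?cardG_gt0 // ltnn.
have q'K : q^'.-nat #|G : K|.
  apply/pnatP=> // l l_pr; rewrite iK //.
  case/(prime_dvd_prod_seq _ _ l_pr) => j; rewrite mem_index_iota ltnS /= => le_ji.
  have lt_jr := leq_ltn_trans le_ji lt_ir.
  have j_pr : prime (ith_prime n j).
    by have := ith_prime_mem lt_jr; rewrite mem_primes => /andP[].
  rewrite Euclid_dvdX // dvdn_prime2 // => /andP[/eqP-> _].
  rewrite !inE neq_ltn; apply/orP; left; apply: leq_ltn_trans lt_pq.
  move: le_ji; rewrite leq_eqVlt => /predU1P[-> | lt_ji]; first by rewrite pi.
  by rewrite -pi ltnW // ith_prime_ltn.
(* All primes dividing [#|G : K|] are at most [p], hence less than [q], so the [q]-group [A] has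
   trivial image in [G / K]. *)
have sAK : A \subset K.
  have nKG := normal_norm nK.
  rewrite -quotient_sub1 ?(subset_trans sAG) // -(setIidPl (quotientS K sAG)).
  rewrite coprime_TIg //; apply: pnat_coprime (quotient_pgroup _ qA) _.
  by rewrite card_quotient.
have KV1 : K :&: V = 1.
  by rewrite setIC; apply: coprime_TIg; exact: pnat_coprime pV p'K.
apply/commG1P/trivgP; rewrite -KV1 commg_subI // subsetI ?sAK ?subxx //=.
exact: subset_trans sVG (normal_norm nK).
Qed.

(** * Groups with a noncentral coprime action *)

Section AffineGroup.

Import GRing.Theory.
Variables (F : finFieldType) (u : F).
Hypothesis nz_u : (u != 0)%R.

(** Translations and the multiplication by [u] are both taken as permutations of [F], so that the
    action becomes conjugation inside one ambient group. *)
Let tr (a : F) : {perm F} := perm (addIr a).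
Let dil : {perm F} := perm (mulIf nz_u).

Let trM a b : tr a * tr b = tr (a + b)%R.
Proof. by apply/permP=> x; rewrite permM !permE addrA. Qed.

Let tr_dil a : tr a * dil = dil * tr (a * u)%R.
Proof. by apply/permP=> x; rewrite !permM !permE mulrDl. Qed.

Let group_set_tr : group_set [set tr a | a : F].
Proof.
apply/group_setP; split=> [|_ _ /imsetP[a _ ->] /imsetP[b _ ->]].
  by apply/imsetP; exists 0%R => //; apply/permP=> x; rewrite perm1 permE addr0.
by rewrite trM imset_f.
Qed.

(** Conjugation by [dil] sends [tr a] to [tr (a * u)]; it therefore preserves the translations, and
    fixes [tr 1] only if [u = 1]. *)
Lemma affine_group_norm_ncent :
  exists (V : {group {perm F}}) (d : {perm F}),
    [/\ #|V| = #|F|, d \in 'N(V), u != 1%R -> d \notin 'C(V) &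
        forall m, (u ^+ m)%R = 1%R -> d ^+ m = 1].
Proof.
exists (Group group_set_tr), dil; split=> [|||m um1].
- rewrite card_imset // => a b /permP/(_ 0%R).
  by rewrite !permE !add0r.
- rewrite inE; apply/subsetP=> _ /imsetP[_ /imsetP[a _ ->] ->].
  by rewrite conjgE tr_dil mulKg imset_f.
- apply: contra => /centP/(_ (tr 1%R)) /(_ (imset_f _ _)) => /(_ isT) comm.
  have /permP/(_ 0%R) := comm; rewrite !permM !permE mul0r !add0r mul1r.
  by move=> ->.
apply/permP=> x; rewrite perm1 permX.
suff -> : iter m dil x = (x * u ^+ m)%R by rewrite um1 mulr1.
by elim: m {um1} => [|m IHm] /=; rewrite ?mulr1 // IHm permE exprSr mulrA.
Qed.

End AffineGroup.

Lemma nontrivial_coprime_action (p q k : nat) :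
    prime p -> prime q -> 0 < k -> (q %| p ^ k - 1)%N ->
  exists (gT : finGroupType) (V A : {group gT}),
    [/\ #|V| = (p ^ k)%N, #|A| = q, A \subset 'N(V) & ~~ (A \subset 'C(V))].
Proof.
move=> p_pr q_pr k_gt0 q_dvd.
have [F _ oF] := pPrimePowerField p_pr k_gt0.
have [|w _ ow] := @Cauchy _ q [set: {unit F}] q_pr.
  by rewrite card_finField_unit oF -subn1.
pose u := FinRing.uval w.
have nz_u : (u != 0)%R by rewrite -GRing.unitfE; apply: (valP w).
have uX m : (u ^+ m)%R = FinRing.uval (w ^+ m) by rewrite FinRing.val_unitX.
have u1 : (u != 1)%R.
  apply: contraTneq (prime_gt1 q_pr) => u1; rewrite -ow -leqNgt.
  suff -> : w = 1 by rewrite order1.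
  exact: val_inj.
have [V [d [oV nVd nCd dX]]] := affine_group_norm_ncent nz_u.
exists _, V, <[d]>%G; split; rewrite ?cycle_subG ?nCd ?oV //.
apply: nt_prime_order => //; first by apply: dX; rewrite uX -ow expg_order.
by apply: contraNneq (nCd u1) => ->; apply: group1.
Qed.

(** A direct factor of order [m] adjusts the order without affecting the action of [A] on [V]. *)
Lemma noncentralising_group_of_order (p q k m : nat) :
    prime p -> prime q -> p != q -> 0 < k -> (q %| p ^ k - 1)%N -> 0 < m ->
  exists (gT : finGroupType) (G V A : {group gT}),
    [/\ #|G| = (p ^ k * q * m)%N, p.-group V && (V \subset G),
        q.-group A && (A \subset G), A \subset 'N(V) & ~~ (A \subset 'C(V))].
Proof.
move=> p_pr q_pr neq_pq k_gt0 q_dvd m_gt0.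
have [gT [V [A [oV oA nVA nCA]]]] := nontrivial_coprime_action p_pr q_pr k_gt0 q_dvd.
have pV : p.-group V by rewrite /pgroup oV pnatX pnat_id.
have qA : q.-group A by rewrite /pgroup oA pnat_id.
(* This is the cyclic group of order [m]; the form [m.-1.+1] shows the type to be nonempty, as its
   group structure requires. *)
pose Z := [set: 'I_m.-1.+1]%G.
pose f := @pairg1 gT 'I_m.-1.+1.
have inj_f : 'injm f := @injm_pairg1 _ _.
have sf (H : {group gT}) : H \subset V <*> A -> f @* H \subset setX (V <*> A) Z.
  by rewrite morphim_pairg1 => sH; rewrite setXS ?sub1G.
exists _, (setX_group (V <*> A) Z), (f @* V)%G, (f @* A)%G.
split; rewrite ?morphim_pgroup ?sf ?joing_subl ?joing_subr ?morphim_norms //=.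
  rewrite cardsX cardsT card_ord prednK // norm_joinEr // coprime_cardMg ?oV ?oA //.
  by rewrite coprimeXl // prime_coprime // dvdn_prime2.
by rewrite (injm_cents inj_f) ?subsetT.
Qed.

Local Open Scope nat_scope.

Theorem mainTheorem6 (n : nat) (n_gt0 : 0 < n) :
  (forall (gT : finGroupType) (G : {group gT}), #|G| = n -> ordered_sylow_tower G)
  <->
  (forall i, i < size (primes n) ->
     gcdn (\prod_(i <= j < size (primes n)) ith_pp n j) (psi (ith_pp n i)) = 1).
Proof.
apply: iff_trans (iff_sym (gcd_psi_eq1P n)).
split=> [tower p q p_n q_n lt_pq k /andP[k_gt0 le_k] | ndvd gT G oG]; last first.
  by apply: ordered_sylow_tower_pcore; rewrite oG.
have := p_n; rewrite mem_primes => /and3P[p_pr _ p_dvd].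
have := q_n; rewrite mem_primes => /and3P[q_pr _ q_dvd].
have neq_pq : p != q by rewrite ltn_eqF.
apply/negP=> q_dvd1.
have cop : coprime (p ^ k) q by rewrite coprimeXl // prime_coprime // dvdn_prime2.
have pkq_dvd : (p ^ k * q %| n)%N by rewrite Gauss_dvd // pfactor_dvdn // le_k.
(* The cofactor of [p ^ k * q] in [n] is the order of the padding factor, which makes the
   counterexample have order exactly [n]. *)
have m_gt0 : 0 < n %/ (p ^ k * q).
  by rewrite divn_gt0 ?muln_gt0 ?expn_gt0 ?prime_gt0 // dvdn_leq.
have [gT [G [V [A [oG /andP[pV sVG] /andP[qA sAG] nVA /negP[]]]]]] :=
  noncentralising_group_of_order p_pr q_pr neq_pq k_gt0 q_dvd1 m_gt0.
apply: (ordered_sylow_tower_cent _ lt_pq p_pr q_pr pV qA sVG sAG nVA).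
by apply: tower; rewrite oG mulnC divnK.
Qed.
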